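(* Let $(A_n)$ be a sequence of sets with $A_n\subseteq[n]$ that are quasi-Sidon, i.e. $|A_n+A_n|=(1+o(1))\binom{|A_n|}{2}$ as $n\to\infty$. Then $$|A_n|\le \left(\left(\frac14+\frac{1}{(\pi+2)^2}\right)^{-1/2}+o(1)\right) n^{1/2}=(1.863\ldots+o(1))\, n^{1/2}.$$
   Context: $[n]=\{1,\dots,n\}$. For a set $A$ of integers, $A+A=\{a+b: a,b\in A\}$. *)

(* Defs.v *)
From HB Require Import structures.
From mathcomp Require Import all_boot all_order all_algebra finmap.
From mathcomp Require Import all_classical all_reals all_analysis.
Set Implicit Arguments. Unset Strict Implicit. Unset Printing Implicit Defensive.
Import Order.TTheory GRing.Theory Num.Theory.
Local Open Scope fset_scope.

Definition sumset (A : {fset nat}) : {fset nat} :=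
  [fset (a + b)%N | a in A, b in A].

(* Main.v *)
(* Let f(t) = sum_(a in A) e^(iat) and S = A + A. Since most elements
   of S have exactly two representations, f(t)^2 is close to
   2 sum_(s in S) e^(ist); for t a nonzero multiple of pi/n this equals minus the
   sum over the complement of S in [2n], so |f(t)|^2 <= 4n - |A|^2 + o(|A|^2).
   On the other hand, for a in [0, n] the discrete Fourier expansion of the sine
   arch reads
     sin(pi a / n) + sum_(0 < m < n) w_m cos(2 pi m a / n) = c
   with w_m >= 0 and c = sum_m w_m = cot(pi / (2n)) / n -> 2 / pi. Summing it
   over a in A gives c |A| <= (1 + c) max |f|, i.e. max |f| >= (2/(pi+2) - o(1)) |A|,
   and comparing the two bounds yields |A|^2 (1 + (2/(pi+2))^2) <= (4 + o(1)) n. *)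
Require Import Defs.
From HB Require Import structures.
From mathcomp Require Import all_boot all_order all_algebra finmap.
From mathcomp Require Import all_classical all_reals all_analysis.
From mathcomp Require Import ring lra zify.
Import Order.TTheory GRing.Theory Num.Theory.
Local Open Scope ring_scope.

(** * Counting representations in the sumset *)

Lemma mem_sumset (A : {fset nat}) (s : nat) :
  reflect (exists a b, [/\ a \in A, b \in A & s = (a + b)%N]) (s \in sumset A).
Proof.
apply: (iffP idP) => [/imfset2P[a aA [b bA ->]]|[a [b [aA bA ->]]]].
  by exists a, b.
by apply/imfset2P; exists a => //; exists b.
Qed.

Lemma sum_fset_const (R : pzRingType) (A : {fset nat}) (c : R) :
  \sum_(a <- A) c = (#|` A|)%:R * c.
Proof. by rewrite big_const_seq count_predT iter_addr_0 mulr_natl. Qed.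

(* A sum [a + b] with [a != b] is hit by both [(a, b)] and [(b, a)]; a sum
   [a + a] may be hit only once, which the diagonal term makes up for. *)
Lemma sumset_weight_le (R : realDomainType) (A : {fset nat}) (h : nat -> R) :
  (forall s, 0 <= h s) ->
  2 * \sum_(s <- sumset A) h s <=
  \sum_(a <- A) \sum_(b <- A) h (a + b)%N + \sum_(a <- A) h (a + a)%N.
Proof.
move=> h0.
(* Regrouping by the value of the sum reduces the claim to one inequality per [s] in the sumset. *)
have fib (a b : nat) : a \in A -> b \in A ->
    h (a + b)%N = \sum_(s <- sumset A) if s == (a + b)%N then h s else 0.
  move=> aA bA; rewrite (bigD1_seq (a + b)%N) ?fset_uniq //=; last first.
    by apply/mem_sumset; exists a, b.
  by rewrite eqxx big1 ?addr0 // => s /negPf->.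
have -> : \sum_(a <- A) \sum_(b <- A) h (a + b)%N =
    \sum_(s <- sumset A) \sum_(a <- A) \sum_(b <- A)
       if s == (a + b)%N then h s else 0.
  rewrite [RHS]exchange_big /=; apply: eq_big_seq => a aA.
  by rewrite [RHS]exchange_big /=; apply: eq_big_seq => b bA; exact: fib.
have -> : \sum_(a <- A) h (a + a)%N =
    \sum_(s <- sumset A) \sum_(a <- A) if s == (a + a)%N then h s else 0.
  by rewrite [RHS]exchange_big /=; apply: eq_big_seq => a aA; exact: fib.
rewrite -big_split mulr_sumr /= big_seq [leRHS]big_seq; apply: ler_sum => s sS.
have ge0 (c : bool) : 0 <= (if c then h s else 0) by case: c.
case/mem_sumset: sS => a [b [aA bA sE]].
have one (c d : nat) : c \in A -> s = (c + d)%N -> d \in A ->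
    h s <= \sum_(b <- A) if s == (c + b)%N then h s else 0.
  move=> cA sE' dA; rewrite (bigD1_seq d) ?fset_uniq //= -sE' eqxx lerDl.
  exact: sumr_ge0.
rewrite mulr2n mulrDl mul1r.
case: (eqVneq a b) => [ab|ab]; first subst b.
  apply: lerD.
    rewrite (bigD1_seq a) ?fset_uniq //=.
    apply: le_trans (one _ _ aA sE bA) _; rewrite lerDl.
    by apply: sumr_ge0 => *; exact: sumr_ge0.
  by rewrite (bigD1_seq a) ?fset_uniq //= -sE eqxx lerDl sumr_ge0.
rewrite -[leLHS]addr0; apply: lerD; last exact: sumr_ge0.
rewrite (bigD1_seq a) ?fset_uniq //=; apply: lerD; first exact: one sE bA.
rewrite big_mkcond (bigD1_seq b) ?fset_uniq //= eq_sym ab.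
apply: le_trans (one _ _ bA _ aA) _; first by rewrite addnC.
by rewrite lerDl; apply: sumr_ge0 => i _; case: ifP => // _; exact: sumr_ge0.
Qed.

(** Apply [sumset_weight_le] to [1 - g], which is nonnegative, and bound the sum of [1 + g] over the
    sumset by its sum over all of [1, 2n], which is 2n because [g] has mean zero there. *)
Lemma sumset_char_le (R : realDomainType) (A : {fset nat}) (n : nat)
    (g : nat -> R) :
  {in A, forall x, 1 <= x <= n}%N ->
  (forall s, `|g s| <= 1) -> \sum_(s < n + n) g s.+1 = 0 ->
  \sum_(a <- A) \sum_(b <- A) g (a + b)%N <=
  4 * n%:R + (#|` A|)%:R ^+ 2 + 2 * (#|` A|)%:R - 4 * (#|` sumset A|)%:R.
Proof.
move=> An g1 gsum.
have g1' s : -1 <= g s /\ g s <= 1 by apply/andP; rewrite -ler_norml.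
have := @sumset_weight_le R A (fun s => 1 - g s) _.
move=> /(_ (fun s => ltac:(have := g1' s; lra))) /=.
have -> : \sum_(a <- A) \sum_(b <- A) (1 - g (a + b)%N) =
   (#|` A|)%:R ^+ 2 - \sum_(a <- A) \sum_(b <- A) g (a + b)%N.
  under eq_bigr do rewrite sumrB sum_fset_const mulr1.
  by rewrite sumrB sum_fset_const expr2.
rewrite sumrB sum_fset_const mulr1.
have diag : \sum_(a <- A) (1 - g (a + a)%N) <= (#|` A|)%:R * 2.
  by rewrite -sum_fset_const; apply: ler_sum => a _; have := g1' (a + a)%N; lra.
have key : \sum_(s <- sumset A) (1 + g s) <= 2 * n%:R.
  have -> : 2 * n%:R = \sum_(s <- iota 1 (n + n)) (1 + g s).
    rewrite -[1%N]addn0 iotaDl big_map /=.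
    have -> : iota 0 (n + n) = index_iota 0 (n + n) by rewrite /index_iota subn0.
    rewrite big_mkord big_split /= gsum addr0 sumr_const card_ord natrD; ring.
  rewrite [leRHS](bigID (mem (sumset A))) /=.
  rewrite -[leLHS]addr0; apply: lerD; last first.
    by apply: sumr_ge0 => s _; have := g1' s; lra.
  rewrite le_eqVlt; apply/orP; left; apply/eqP.
  rewrite -[RHS]big_filter; apply: perm_big; apply: uniq_perm.
  - exact: fset_uniq.
  - by rewrite filter_uniq // iota_uniq.
  move=> s; rewrite mem_filter mem_iota andb_idr // => /mem_sumset[a [b [aA bA ->]]].
  by have := An _ aA; have := An _ bA; lia.
rewrite big_split /= sum_fset_const mulr1 in key.
lra.
Qed.

(** * Upper bound for the exponential sum at multiples of pi/n *)

Lemma sin_pi_frac_gt0 (R : realType) (N j : nat) : (0 < j < N)%N ->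
  0 < sin (pi * j%:R / N%:R : R).
Proof.
move=> /andP[j0 jN]; apply: sin_gt0_pi.
have N0 : 0 < N%:R :> R by rewrite ltr0n; lia.
rewrite divr_gt0 ?mulr_gt0 ?pi_gt0 ?N0 ?ltr0n //=.
by rewrite ltr_pdivrMr // ltr_pM2l ?pi_gt0 // ltr_nat.
Qed.

(** Multiplication by [2 * sin x], nonzero since 0 < j < N, makes the sum telescope; its two ends
    differ by j full periods. *)
Lemma sum_cos_eq0 (R : realType) (N j : nat) (z : R) : (0 < j < N)%N ->
  \sum_(m < N) cos (z + 2 * pi * j%:R / N%:R * m%:R) = 0.
Proof.
move=> jN; have := @sin_pi_frac_gt0 R _ _ jN; set x := pi * _ / _ => sx0.
have N0 : N%:R != 0 :> R by rewrite pnatr_eq0; lia.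
have tele M : 2 * sin x * \sum_(m < M) cos (z + 2 * x * m%:R) =
    sin (z - x + 2 * x * M%:R) - sin (z - x).
  elim: M => [|M IH]; first by rewrite big_ord0 !mulr0 addr0 subrr.
  rewrite big_ord_recr /= mulrDr IH.
  have -> : z - x + 2 * x * M.+1%:R = (z + 2 * x * M%:R) + x by rewrite -natr1; ring.
  have -> : z - x + 2 * x * M%:R = (z + 2 * x * M%:R) - x by ring.
  by rewrite (sinD _ x) (sinB (_ + _) x); ring.
have -> : 2 * pi * j%:R / N%:R = 2 * x by rewrite /x; field.
apply: (mulfI (x := 2 * sin x)); first by rewrite mulf_neq0 ?pnatr_eq0 ?gt_eqF.
rewrite tele mulr0.
have -> : z - x + 2 * x * N%:R = z - x + (pi *+ 2) *+ j.
  by rewrite /x -mulr_natl -(mulr_natl pi); field.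
by rewrite (periodicn (@sinD2pi R)) subrr.
Qed.

Lemma sqr_expsum_le (R : realType) (A : {fset nat}) (n j : nat) (t : R) :
  {in A, forall x, 1 <= x <= n}%N -> (0 < j < n + n)%N -> t = pi * j%:R / n%:R ->
  (\sum_(a <- A) cos (t * a%:R)) ^+ 2 + (\sum_(a <- A) sin (t * a%:R)) ^+ 2 <=
  4 * n%:R + (#|` A|)%:R ^+ 2 + 2 * (#|` A|)%:R - 4 * (#|` sumset A|)%:R.
Proof.
move=> An jn tE.
set C := \sum_(a <- A) cos _; set S := \sum_(a <- A) sin _.
set B := (X in _ <= X).
have n0 : n%:R != 0 :> R by rewrite pnatr_eq0; lia.
have tE' : t = 2 * pi * j%:R / (n + n)%:R.
  by rewrite tE addnn -muln2 natrM; field.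
(* With f = C + iS, the left side is the real part of (u - iv) f^2. *)
have twist (u v : R) : u ^+ 2 + v ^+ 2 = 1 ->
    u * (C ^+ 2 - S ^+ 2) + v * (2 * S * C) <= B.
  move=> uv.
  pose g (s : nat) := u * cos (t * s%:R) + v * sin (t * s%:R).
  have -> : u * (C ^+ 2 - S ^+ 2) + v * (2 * S * C) =
      \sum_(a <- A) \sum_(b <- A) g (a + b)%N.
    have -> : \sum_(a <- A) \sum_(b <- A) g (a + b)%N =
       \sum_(a <- A) ((u * cos (t * a%:R) + v * sin (t * a%:R)) * C
         + (v * cos (t * a%:R) - u * sin (t * a%:R)) * S).
      apply: eq_bigr => a _; rewrite !mulr_sumr -big_split /=.
      apply: eq_bigr => b _; rewrite /g natrD mulrDr cosD sinD; ring.
    rewrite big_split /= -!mulr_suml !big_split /= sumrN -!mulr_sumr -/C -/S.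
    ring.
  apply: sumset_char_le => // [s|].
    rewrite -(@ler_sqr _ _ 1) ?nnegrE //.
    rewrite real_normK ?num_real // expr1n /g.
    have cs := cos2Dsin2 (t * s%:R).
    move: (cos _) (sin _) cs => c d cs.
    (* Lagrange's identity, which gives Cauchy-Schwarz here. *)
    have -> : (u * c + v * d) ^+ 2 =
       (u ^+ 2 + v ^+ 2) * (c ^+ 2 + d ^+ 2) - (u * d - v * c) ^+ 2 by ring.
    by rewrite uv cs mulr1 lerBlDr lerDl sqr_ge0.
  rewrite big_split /= -!mulr_sumr.
  have shift z : \sum_(s < n + n) cos (z + t * s.+1%:R) = 0.
    rewrite -[RHS](@sum_cos_eq0 R _ j (z + t) jn) -tE'; apply: eq_bigr => s _.
    by congr cos; rewrite -natr1; ring.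
  have -> : \sum_(s < n + n) cos (t * s.+1%:R) = 0.
    by rewrite -[RHS](shift 0); apply: eq_bigr => s _; rewrite add0r.
  have -> : \sum_(s < n + n) sin (t * s.+1%:R) = 0.
    rewrite -[RHS](shift (- (pi / 2))); apply: eq_bigr => s _.
    by rewrite addrC cosBpihalf.
  by rewrite !mulr0 addr0.
have [|D0] := eqVneq (C ^+ 2 + S ^+ 2) 0.
  move/eqP; rewrite paddr_eq0 ?sqr_ge0 // !sqrf_eq0 => /andP[/eqP C0 /eqP S0].
  by apply: le_trans (twist 1 0 _); rewrite ?C0 ?S0 ?expr0n ?expr1n /=; lra.
(* The unit vector in the direction of f^2 turns the real part into |f|^2; f = 0, where there is no
   direction, was treated above. *)
have := twist ((C ^+ 2 - S ^+ 2) / (C ^+ 2 + S ^+ 2))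
              ((2 * S * C) / (C ^+ 2 + S ^+ 2)).
have -> : (C ^+ 2 - S ^+ 2) / (C ^+ 2 + S ^+ 2) * (C ^+ 2 - S ^+ 2) +
  (2 * S * C) / (C ^+ 2 + S ^+ 2) * (2 * S * C) = C ^+ 2 + S ^+ 2 by field.
by apply; field.
Qed.

(** * Discrete Fourier expansion of the sine arch *)

Definition sine_mean (R : realType) (n : nat) : R :=
  cos (pi / n.*2%:R) / (n%:R * sin (pi / n.*2%:R)).

(* [sine_weight n m] is, up to sign, the coefficient of frequency [m.+1] in the
   discrete Fourier expansion of [a |-> sin (pi * a / n)] over Z/nZ, and
   [sine_mean n] is the constant coefficient. *)
Definition sine_weight (R : realType) (n m : nat) : R :=
  sin (pi / n%:R) /
  (n.*2%:R * sin (pi * m.*2.+1%:R / n.*2%:R) * sin (pi * m.*2.+3%:R / n.*2%:R)).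

Lemma sine_weight_ge0 (R : realType) (n m : nat) : (m < n.-1)%N ->
  0 <= sine_weight R n m.
Proof.
move=> mn; rewrite /sine_weight.
have n0 : 0 < n%:R :> R by rewrite ltr0n; lia.
apply: divr_ge0.
  rewrite -[pi]mulr1; apply: ltW; apply: (@sin_pi_frac_gt0 _ n 1); lia.
by rewrite !mulr_ge0 // ltW // sin_pi_frac_gt0 //; lia.
Qed.

(** Each weight is a difference of cotangents, since sin(q - p) / (sin p sin q) = cot p - cot q. *)
Lemma sum_sine_weight (R : realType) (n : nat) : (1 < n)%N ->
  \sum_(m < n.-1) sine_weight R n m = sine_mean R n.
Proof.
move=> n1; set y : R := pi / n.*2%:R.
have n0 : n%:R != 0 :> R by rewrite pnatr_eq0; lia.
have nE : n.*2%:R = 2 * n%:R :> R by rewrite -muln2 natrM mulrC.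
have piE (m : nat) : pi * m%:R / n.*2%:R = m%:R * y.
  by rewrite /y mulrA (mulrC m%:R).
have sy (m : nat) : (0 < m < n.*2)%N -> sin (m%:R * y) != 0.
  by move=> ?; rewrite -piE gt_eqF // sin_pi_frac_gt0.
pose cot (m : nat) : R := cos (m%:R * y) / sin (m%:R * y).
have tele (M : nat) : (M <= n.-1)%N ->
    \sum_(m < M) sine_weight R n m = (cot 1%N - cot M.*2.+1) / n.*2%:R.
  elim: M => [|M IH] MN; first by rewrite big_ord0 subrr mul0r.
  rewrite big_ord_recr /= IH; last lia.
  rewrite /sine_weight !piE.
  have -> : sin (pi / n%:R) = sin (M.*2.+3%:R * y - M.*2.+1%:R * y) :> R.
    congr sin; rewrite -mulrBl -natrB; last lia.
    have -> : (M.*2.+3 - M.*2.+1 = 2)%N by lia.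
    by rewrite /y nE; field.
  rewrite sinB /cot doubleS nE.
  have s1 := sy M.*2.+1 ltac:(lia).
  have s2 := sy M.*2.+3 ltac:(lia).
  have s3 := sy 1%N ltac:(lia).
  by field; rewrite s1 s2 s3 n0.
rewrite tele // /cot.
(* The last cotangent is minus the first, so the telescoped difference is [2 * cot 1]. *)
have -> : n.-1.*2.+1%:R * y = pi - y.
  have -> : n.-1.*2.+1 = (n.*2 - 1)%N by lia.
  by rewrite natrB ?mulrBl ?mul1r /y; [field; rewrite nE mulf_neq0 | lia].
have sy1 : sin y != 0 by rewrite -[y]mul1r; apply: (sy 1%N); lia.
rewrite mul1r sinB cosB sinpi cospi /sine_mean -/y nE.
by field; rewrite sy1 n0.
Qed.

(* Both sides, as functions of [a], satisfy the same second-order recurrence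
   [f a.+2 + f a = 2 * cos (pi / n) * f a.+1 + const] and agree at 0 and 1. *)
Lemma sine_expansion (R : realType) (n a : nat) : (1 < n)%N -> (a <= n)%N ->
  sin (pi / n%:R * a%:R) +
  \sum_(m < n.-1) sine_weight R n m * cos (pi * m.+1.*2%:R / n%:R * a%:R) =
  sine_mean R n.
Proof.
move=> n1; set y : R := pi / n.*2%:R.
have n0 : n%:R != 0 :> R by rewrite pnatr_eq0; lia.
have nE : n.*2%:R = 2 * n%:R :> R by rewrite -muln2 natrM mulrC.
have yE : pi / n%:R = 2 * y :> R by rewrite /y nE; field.
have sy1 : sin y != 0.
  by rewrite gt_eqF // /y -[pi]mulr1 (@sin_pi_frac_gt0 _ _ 1) //; lia.
pose th (m : nat) : R := pi * m.+1.*2%:R / n%:R.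
pose G (b : R) : R := \sum_(m < n.-1) sine_weight R n m * cos (th m * b).
have GN b : G (- b) = G b.
  by apply: eq_bigr => m _; rewrite mulrN cosN.
have rec b : G (b + 1) + G (b - 1) = 2 * cos (2 * y) * G b
    - 2 / n%:R * sin (2 * y) * \sum_(m < n.-1) cos (th m * b).
  rewrite /G !mulr_sumr -big_split -sumrB /=; apply: eq_bigr => m _.
  have mn := ltn_ord m.
  set w := sine_weight _ _ _.
  (* The difference of cosines is -4 sin p sin q, which cancels the denominator of the weight. *)
  have ww : w * (2 * cos (th m) - 2 * cos (2 * y)) = - (2 / n%:R * sin (2 * y)).
    rewrite /w /sine_weight yE.
    set p := pi * m.*2.+1%:R / n.*2%:R; set q := pi * m.*2.+3%:R / n.*2%:R.
    have p0 : sin p != 0 by rewrite gt_eqF // sin_pi_frac_gt0 //; lia.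
    have q0 : sin q != 0 by rewrite gt_eqF // sin_pi_frac_gt0 //; lia.
    have -> : th m = q + p.
      rewrite /th /p /q nE -[_.*2.+3]addn3 -[_.*2.+1]addn1 doubleS -[_.*2.+2]addn2.
      by rewrite !natrD; field.
    have -> : cos (2 * y) = cos (q - p).
      by congr cos; rewrite /y /p /q nE -[_.*2.+3]addn3 -[_.*2.+1]addn1 !natrD; field.
    by rewrite cosD cosB nE; field; rewrite p0 q0 n0.
  rewrite !mulrDr !mulr1 mulrN1 cosD cosB.
  transitivity (w * (2 * cos (th m) - 2 * cos (2 * y)) * cos (th m * b)
    + 2 * cos (2 * y) * (w * cos (th m * b))); first by ring.
  by rewrite ww; ring.
have G0 : G 0 = sine_mean R n.
  by rewrite -sum_sine_weight //; apply: eq_bigr => m _; rewrite mulr0 cos0 mulr1.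
have c2 : cos (2 * y) = 1 - 2 * sin y ^+ 2.
  by rewrite mulr_natl cos_mulr2n cos2sin2; ring.
have s2 : sin (2 * y) = 2 * cos y * sin y.
  by rewrite mulr_natl sin_mulr2n; ring.
have meanE : sine_mean R n * (1 - cos (2 * y)) = sin (2 * y) / n%:R.
  by rewrite c2 s2 /sine_mean -/y; field; rewrite sy1 n0.
(* [G] is even, so the recurrence at 0 determines [G 1] from [G 0]. *)
have G1 : sin (2 * y) + G 1 = sine_mean R n.
  have := rec 0; rewrite add0r sub0r GN G0.
  under eq_bigr do rewrite mulr0 cos0.
  rewrite sumr_const card_ord -subn1 natrB; last lia.
  have -> : 2 / n%:R * sin (2 * y) * (n%:R - 1) = 2 * sin (2 * y) - 2 * (sin (2 * y) / n%:R).
    by field.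
  by rewrite -meanE => ?; lra.
suff main b : (b < n)%N -> sin (2 * y * b%:R) + G b%:R = sine_mean R n /\
    sin (2 * y * b.+1%:R) + G b.+1%:R = sine_mean R n.
  rewrite yE; case: a => [_|a an]; last by have [] := main a an.
  by have [] := main 0%N ltac:(lia).
elim: b => [|b IH] bn; first by rewrite !mulr0 sin0 add0r mulr1.
have [H0 H1] := IH ltac:(lia); split => //.
(* The sum over all n frequencies vanishes; removing frequency 0, which contributes 1, leaves -1. *)
have cs : \sum_(m < n.-1) cos (th m * b.+1%:R) = -1.
  have := @sum_cos_eq0 R n b.+1 0 ltac:(lia).
  rewrite -(big_mkord xpredT (fun m : nat => cos (0 + 2 * pi * b.+1%:R / n%:R * m%:R))).
  rewrite big_ltn ?big_add1 ?big_mkord; last lia.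
  rewrite mulr0 addr0 cos0 => /eqP; rewrite addrC addr_eq0 => /eqP <-.
  apply: eq_bigr => m _; congr cos; rewrite add0r /th -muln2 natrM.
  by field.
have := rec b.+1%:R; rewrite cs.
have -> : b.+1%:R - 1 = b%:R :> R by rewrite -natr1 addrK.
rewrite natr1.
have -> : sin (2 * y * b.+2%:R) = 2 * cos (2 * y) * sin (2 * y * b.+1%:R) - sin (2 * y * b%:R).
  have -> : 2 * y * b.+2%:R = 2 * y * b.+1%:R + 2 * y by rewrite -natr1; ring.
  have -> : 2 * y * b%:R = 2 * y * b.+1%:R - 2 * y by rewrite -natr1; ring.
  by rewrite sinD sinB; ring.
have -> : G b.+1%:R = sine_mean R n - sin (2 * y * b.+1%:R) by rewrite -H1; ring.
have -> : G b%:R = sine_mean R n - sin (2 * y * b%:R) by rewrite -H0; ring.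
have -> : 2 / n%:R * sin (2 * y) * -1 = - 2 * (sin (2 * y) / n%:R) by ring.
rewrite -meanE mulrBr => E.
by rewrite -[G b.+2%:R](addrK (sine_mean R n - sin (2 * y * b%:R))) E; ring.
Qed.

(** * Lower bound for the largest exponential sum *)

Lemma sine_mean_ratio_le (R : realType) (A : {fset nat}) (n : nat) (M : R) :
  (1 < n)%N -> {in A, forall x, 1 <= x <= n}%N ->
  0 <= M ->
  4 * n%:R + (#|` A|)%:R ^+ 2 + 2 * (#|` A|)%:R - 4 * (#|` sumset A|)%:R <= M ^+ 2 ->
  sine_mean R n * (#|` A|)%:R <= (1 + sine_mean R n) * M.
Proof.
move=> n1 An M0 AM.
have bnd (t : R) (j : nat) : (0 < j < n + n)%N -> t = pi * j%:R / n%:R ->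
    \sum_(a <- A) cos (t * a%:R) <= M /\ \sum_(a <- A) sin (t * a%:R) <= M.
  move=> jn tE; have := le_trans (@sqr_expsum_le R A n j t An jn tE) AM.
  move: (\sum_(a <- A) _) (\sum_(a <- A) _) => C S CS.
  by split; apply: le_trans (ler_norm _) _; rewrite -(@ler_sqr R) ?nnegrE //
     real_normK ?num_real // (le_trans _ CS) // ?lerDl ?lerDr sqr_ge0.
have -> : sine_mean R n * (#|` A|)%:R =
    \sum_(a <- A) (sin (pi / n%:R * a%:R) +
      \sum_(m < n.-1) sine_weight R n m * cos (pi * m.+1.*2%:R / n%:R * a%:R)).
  rewrite big_seq; under eq_bigr => a aA.
    rewrite sine_expansion //; last by have := An _ aA; lia.
  over.
  by rewrite -big_seq big_const_seq count_predT iter_addr_0 mulr_natr.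
rewrite big_split /= exchange_big /= [leRHS]mulrDl mul1r; apply: lerD.
  (* The arch itself has the odd frequency j = 1, so the bound is needed at all multiples of pi/n;
     the cosines below use only even j. *)
  by apply: (bnd _ 1%N _ _).2; [lia | rewrite mulr1].
rewrite -sum_sine_weight // mulr_suml; apply: ler_sum => m _.
have mn := ltn_ord m.
rewrite -mulr_sumr; apply: ler_wpM2l; first exact: sine_weight_ge0.
by apply: (bnd _ m.+1.*2 _ _).1 => //; lia.
Qed.

Lemma sin_le_id (R : realType) (x : R) : 0 <= x -> sin x <= x.
Proof.
move=> x0; have [|c _] := @MVT_segment R (@sin R) (@cos R) 0 x x0 (fun z _ => is_derive_sin z).
  by apply: derivable_within_continuous => z _; exact: derivable_sin.
rewrite sin0 !subr0 => ->; rewrite -[leRHS]mul1r.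
by apply: ler_wpM2r => //; exact: cos_le1.
Qed.

(** From sin y <= y the mean is at least 2 cos y / pi, and cos y <= 1 then bounds the ratio below by
    2 cos y / (pi + 2). Squaring loses only a multiple of sin^2 y, at most 1/n^2 <= 1/n. *)
Lemma sine_ratio_ge (R : realType) (n : nat) : (1 < n)%N ->
  0 <= sine_mean R n /\
  (2 / (pi + 2)) ^+ 2 - n%:R^-1 <=
  (sine_mean R n / (1 + sine_mean R n)) ^+ 2.
Proof.
move=> n1; set y : R := pi / n.*2%:R.
have n0 : 0 < n%:R :> R by rewrite ltr0n; lia.
have nE : n.*2%:R = 2 * n%:R :> R by rewrite -muln2 natrM mulrC.
have p0 := @pi_gt0 R.
have y0 : 0 < y by rewrite /y nE divr_gt0 ?mulr_gt0.
have yn : n%:R * y = pi / 2 by rewrite /y nE; field; rewrite gt_eqF.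
have sy0 : 0 < sin y by rewrite /y -[pi]mulr1 (@sin_pi_frac_gt0 _ _ 1) //; lia.
have cy0 : 0 <= cos y.
  apply: cos_ge0_pihalf; apply/andP; split; first by lra.
  rewrite /y nE ler_pM2l // lef_pV2 ?posrE ?mulr_gt0 //.
  by rewrite ler_peMr // ler1n; lia.
have c1 := cos_le1 y.
have sle := @sin_le_id R y (ltW y0).
have mean_ge : 2 * cos y / pi <= sine_mean R n.
  rewrite /sine_mean -/y.
  have -> : 2 * cos y / pi = cos y / (n%:R * y).
    by rewrite yn invf_div mulrA (mulrC (cos y)).
  apply: ler_wpM2l => //.
  have ny0 : 0 < n%:R * y := mulr_gt0 n0 y0.
  have ns0 : 0 < n%:R * sin y := mulr_gt0 n0 sy0.
  by rewrite lef_pV2 ?posrE // ler_pM2l.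
have l0 : 0 <= 2 * cos y / pi by rewrite divr_ge0 ?mulr_ge0 // ltW.
split; first exact: le_trans l0 mean_ge.
set c := sine_mean R n in mean_ge *.
have c0 : 0 <= c := le_trans l0 mean_ge.
have q0 : 0 < pi + 2 :> R by rewrite addr_gt0.
have r_ge : 2 / (pi + 2) * cos y <= c / (1 + c).
  rewrite mulrAC ler_pdivlMr ?ltr_wpDr // [leLHS]mulrAC ler_pdivrMr //.
  move: mean_ge; rewrite ler_pdivrMr // => h.
  have : cos y * c <= c by rewrite -[leRHS]mul1r; exact: ler_wpM2r.
  by lra.
have r0 : 0 <= 2 / (pi + 2) * cos y by rewrite mulr_ge0 // divr_ge0 // ltW.
apply: le_trans (_ : (2 / (pi + 2) * cos y) ^+ 2 <= _); last first.
  by rewrite ler_sqr ?nnegrE // (le_trans r0).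
rewrite [(_ * cos y) ^+ 2]exprMn cos2sin2 mulrBr mulr1 lerD2l lerN2.
have p2 : 2 / (pi + 2) * sin y <= n%:R^-1.
  apply: le_trans (_ : 2 / (pi + 2) * y <= _).
    by apply: ler_wpM2l => //; rewrite divr_ge0 // ltW.
  rewrite -[leRHS]mul1r ler_pdivlMr // -[leLHS]mulrA (mulrC y) yn [leLHS]mulrAC.
  by rewrite ler_pdivrMr //; lra.
rewrite -exprMn; apply: le_trans (_ : n%:R^-1 ^+ 2 <= _).
  by rewrite ler_sqr // ?nnegrE ?invr_ge0 ?ltW // mulr_gt0 // divr_gt0.
by rewrite expr2 ler_piMr ?invr_ge0 ?ltW // invf_lt1 // ltr1n.
Qed.

Lemma sqr_sine_ratio_le (R : realType) (A : {fset nat}) (n : nat) :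
  (1 < n)%N -> {in A, forall x, 1 <= x <= n}%N ->
  (sine_mean R n / (1 + sine_mean R n)) ^+ 2 * (#|` A|)%:R ^+ 2 <=
  4 * n%:R + (#|` A|)%:R ^+ 2 + 2 * (#|` A|)%:R - 4 * (#|` sumset A|)%:R.
Proof.
move=> n1 An; set B := (X in _ <= X).
(* [B] bounds a squared modulus, here at j = 1, so [Num.sqrt B] can serve as [M]. *)
have B0 : 0 <= B.
  by apply: le_trans (@sqr_expsum_le R A n 1 _ An _ erefl); [rewrite addr_ge0 ?sqr_ge0 | lia].
have [c0 _] := sine_ratio_ge R n n1.
have := @sine_mean_ratio_le R A n (Num.sqrt B) n1 An (sqrtr_ge0 _).
rewrite sqr_sqrtr // => /(_ (lexx _)).
move: (sine_mean R n) c0 => c c0 h.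
rewrite -exprMn -[leRHS]sqr_sqrtr // ler_sqr ?nnegrE ?sqrtr_ge0 //; last first.
  by rewrite mulr_ge0 // divr_ge0 // addr_ge0.
by rewrite mulrAC ler_pdivrMr ?ltr_wpDr // [leRHS]mulrC.
Qed.

(** * Comparison of the two bounds *)

Lemma natr_bin2 (R : comPzRingType) (k : nat) :
  2 * ('C(k, 2))%:R = k%:R ^+ 2 - k%:R :> R.
Proof.
elim: k => [|k IH]; first by rewrite mulr0 expr0n subrr.
by rewrite binS bin1 natrD mulrDr IH -natr1; ring.
Qed.

Theorem theorem3 (R : realType) (A : nat -> {fset nat}) :
  (* A_n is a subset of [n] = {1,...,n} *)
  (forall n x, x \in A n -> (1 <= x <= n)%N) ->
  (* quasi-Sidon: |A_n + A_n| = (1 + o(1)) * binom(|A_n|, 2) *)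
  (forall e : R, 0 < e -> exists N : nat, forall n : nat, (N <= n)%N ->
     `| (#|` sumset (A n)|)%:R - ('C(#|` A n|, 2))%:R | <= e * ('C(#|` A n|, 2))%:R) ->
  (* |A_n| <= ((1/4 + 1/(pi+2)^2)^(-1/2) + o(1)) * n^(1/2) *)
  forall e : R, 0 < e -> exists N : nat, forall n : nat, (N <= n)%N ->
     (#|` A n|)%:R <= ((Num.sqrt (1 / 4 + 1 / (pi + 2) ^+ 2))^-1 + e) * Num.sqrt (n%:R).
Proof.
move=> An hS e e0.
set L := 1 / 4 + _; set b := _^-1 + e; pose q : R := 2 / (pi + 2).
have q20 : 0 < pi + 2 :> R by rewrite addr_gt0 ?pi_gt0.
have LE : 4 * L = 1 + q ^+ 2.
  rewrite /L /q; move: (pi + 2) q20 => p p0.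
  by field; rewrite gt_eqF.
have L0 : 0 < L by have := sqr_ge0 q; lra.
have sL0 : 0 < Num.sqrt L by rewrite sqrtr_gt0.
have b0 : 0 < b by rewrite addr_gt0 // invr_gt0.
have bL : b^-1 ^+ 2 < L.
  rewrite -[ltRHS]sqr_sqrtr ?(ltW L0) // ltr_sqr ?nnegrE ?invr_ge0 ?ltW //.
  by rewrite -[ltRHS]invrK ltf_pV2 ?posrE ?invr_gt0 // ltrDl.
(* If k = |A_n| exceeded [b * Num.sqrt n], the main terms would differ by more than d k^2. Three
   errors, each at most (d/4) k^2, cannot fill this gap: the quasi-Sidon defect (tolerance d/8, as 4
   binom(k,2) = 2(k^2 - k)), the loss k^2/n, and the linear term 4k. *)
have [d d0 dE] : exists2 d, 0 < d & d = 4 * L - 4 * b^-1 ^+ 2.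
  by eexists; last reflexivity; lra.
have [N1 hN1] := hS (d / 8) ltac:(lra).
have d4 : 0 <= 4 / d by rewrite divr_ge0 // ltW.
have x0 : 0 <= 16 / d / b by rewrite !divr_ge0 // ltW.
(* [N2] ensures 1/n <= d/4; [N3] makes [b * Num.sqrt n] at least 16/d, so the negated claim forces k
   > 16/d. *)
have := archi_boundP d4; move: (Num.bound _) => N2 hN2.
have := archi_boundP (sqr_ge0 (16 / d / b)); move: (Num.bound _) => N3 hN3.
exists (N1 + N2 + N3 + 2)%N => n nN.
have [n1 nN1 nN2 nN3] : [/\ 1 < n, N1 <= n, N2 <= n & N3 <= n]%N.
  by move: nN; clear; split; lia.
have n0 : 0 < n%:R :> R by rewrite ltr0n ltnW.
have nd : n%:R^-1 <= d / 4.
  rewrite -[leRHS]invf_div lef_pV2 ?posrE ?divr_gt0 //.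
  by apply: ltW; apply: lt_le_trans hN2 _; rewrite ler_nat.
have nsq : 16 / d / b <= Num.sqrt n%:R.
  rewrite -(@ler_sqr R) ?nnegrE ?sqrtr_ge0 // sqr_sqrtr ?(ltW n0) //.
  by apply: ltW; apply: lt_le_trans hN3 _; rewrite ler_nat.
rewrite leNgt; apply/negP => kgt.
have [_ ratio] := sine_ratio_ge R n n1.
have main := @sqr_sine_ratio_le R (A n) n n1 (An n).
have := hN1 n nN1; rewrite ler_norml => /andP[+ _].
have := natr_bin2 R #|` A n|.
rewrite -/q in ratio.
move: kgt main; move: ('C(_, _)%:R : R) (#|` sumset _|%:R : R) (#|` A n|%:R : R).
move=> C s k kgt main Ck sC.
have k16 : 16 / d < k.
  by apply: (le_lt_trans _ kgt); rewrite [leRHS]mulrC -ler_pdivrMr.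
have k0 : 0 < k by apply: (le_lt_trans _ k16); rewrite divr_ge0 // ltW.
have nk : n%:R < b^-1 ^+ 2 * k ^+ 2.
  rewrite -exprMn -[ltLHS]sqr_sqrtr ?ltW // ltr_sqr ?nnegrE ?sqrtr_ge0 ?mulr_ge0 ?invr_ge0 ?ltW //.
  by rewrite [ltRHS]mulrC ltr_pdivlMr // mulrC.
have k4 : 4 * k <= d / 4 * k ^+ 2.
  by move: k16; rewrite ltr_pdivrMr // expr2 mulrA => k16; apply: ler_wpM2r; lra.
have kk : 0 < k ^+ 2 by rewrite exprn_gt0.
have := ler_wpM2r (ltW kk) ratio.
have := ler_wpM2r (ltW kk) nd.
have dk := mulr_gt0 d0 k0.
have dkk := mulr_gt0 d0 kk.
have sE : 2 * (d / 8 * C) = d * k ^+ 2 / 8 - d * k / 8.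
  by transitivity (d / 8 * (2 * C)); [ring | rewrite Ck; ring].
have qE : q ^+ 2 * k ^+ 2 = 4 * (b^-1 ^+ 2 * k ^+ 2) + d * k ^+ 2 - k ^+ 2.
  by rewrite (_ : q ^+ 2 = 4 * b^-1 ^+ 2 + d - 1); [ring | rewrite dE LE; ring].
rewrite mulrBl qE [d / 4 * _]mulrAC; rewrite [d / 4 * _]mulrAC in k4.
lra.
Qed.
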